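(* Let $C\subseteq\mathbb{R}^2$ be a convex cone. (1) If $C$ is pointed with extreme rays $[u_1],[u_2]$, $u_1,u_2\in\mathbb{R}^2$, then $S_C$ is $(R,G)$-finitely generated if and only if either $[u_1],[u_2]$ are both rational, or $u_1,u_2$ are eigenvectors with positive eigenvalues of some non-identity matrix $A\in\mathrm{GL}(2,\mathbb{Z})$. (2) If $C$ is a closed half-plane whose boundary line is spanned by $r\in\mathbb{R}^2$, then $S_C$ is $(R,G)$-finitely generated if and only if either $r$ is rational (i.e. a nonzero real multiple of a rational vector), or $r$ is an eigenvector with positive eigenvalue of some non-identity matrix $A\in\mathrm{GL}(2,\mathbb{Z})$ with $\det(A)=1$.
   Context: For $u\in\mathbb{R}^n$, $[u]=\{cu:c>0\}$; an extreme ray $[u]$ is rational if $[u]=[u']$ for some $u'\in\mathbb{Q}^n$. $\mathrm{GL}(n,\mathbb{Z})$ is the group of integer $n\times n$ matrices with determinant $\pm1$. For a convex cone $C\subseteq\mathbb{R}^n$ let $S_C:=C\cap\mathbb{Z}^n$. $S_C$ is called $(R,G)$-finitely generated if there exist a finite subset $R\subseteq S_C$ and a finitely generated subgroup $G\subseteq\mathrm{GL}(n,\mathbb{Z})$ acting linearly on $C$ (written $x\mapsto T\cdot x$) such that (1) $G\cdot C=C$ and $G\cdot S_C=S_C$, and (2) every $s\in S_C$ can be written as a finite sum $s=\sum_{i}\lambda_i\,T_i\cdot r_i$ with $r_i\in R$, $T_i\in G$, $\lambda_i\in\mathbb{Z}_{\ge0}$. *)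

(* Defs.v *)
From HB Require Import structures.
From mathcomp Require Import all_boot all_order all_algebra.
From mathcomp Require Import all_classical all_reals.

Set Implicit Arguments.
Unset Strict Implicit.
Unset Printing Implicit Defensive.

Import Order.TTheory GRing.Theory Num.Theory.

Local Open Scope classical_set_scope.
Local Open Scope ring_scope.

Definition GLZ (n : nat) : set 'M[int]_n :=
  [set A | \det A = 1 \/ \det A = -1].

Definition subgroup_GLZ (n : nat) (G : set 'M[int]_n) : Prop :=
  [/\ G `<=` @GLZ n,
      G 1%:M,
      (forall A B, G A -> G B -> G (A *m B)) &
      (forall A, G A -> G (invmx A))].

(* The inclusion of X in GL(n,Z) is needed: without it there may be no
   subgroup containing X, and [smallest] would be the full set. *)
Definition fg_subgroup_GLZ (n : nat) (G : set 'M[int]_n) : Prop :=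
  exists X : set 'M[int]_n,
    [/\ finite_set X, X `<=` @GLZ n & G = smallest (@subgroup_GLZ n) X].

Section Cones.
Variables (R : realType) (n : nat).
Implicit Types (C : set 'cV[R]_n) (u x y : 'cV[R]_n) (A T : 'M[int]_n).

Definition act T x : 'cV[R]_n := map_mx intr T *m x.

Definition convex_cone C : Prop :=
  [/\ C 0,
      (forall x y, C x -> C y -> C (x + y)) &
      (forall (c : R) x, 0 <= c -> C x -> C (c *: x))].

Definition pointed C : Prop := forall x, C x -> C (- x) -> x = 0.

Definition ray u : set 'cV[R]_n := [set c *: u | c in [set c : R | 0 < c]].

Definition extreme_vector C u : Prop :=
  [/\ C u, u <> 0 &
      forall x y, C x -> C y -> ray u (x + y) ->
        (x = 0 \/ ray u x) /\ (y = 0 \/ ray u y)].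

Definition extreme_rays C : set (set 'cV[R]_n) :=
  [set ray u | u in [set u | extreme_vector C u]].

Definition rational_ray u : Prop :=
  exists u' : 'cV[rat]_n, ray u = ray (map_mx ratr u').

Definition rational_direction u : Prop :=
  exists (c : R) (u' : 'cV[rat]_n), c <> 0 /\ u = c *: map_mx ratr u'.

Definition pos_eigenvector A u : Prop :=
  u <> 0 /\ exists2 lambda : R, 0 < lambda & act A u = lambda *: u.

Definition integer_points C : set 'cV[R]_n :=
  C `&` range (fun z : 'cV[int]_n => map_mx intr z).

Definition RG_generated C (B : set 'cV[R]_n) (G : set 'M[int]_n) : Prop :=
  [/\ [set act T x | T in G & x in C] = C,
      [set act T x | T in G & x in integer_points C] = integer_points C &
      forall s, integer_points C s ->
        exists (k : nat) (lambda : 'I_k -> nat) (T : 'I_k -> 'M[int]_n)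
               (r : 'I_k -> 'cV[R]_n),
          (forall i, G (T i) /\ B (r i)) /\
          s = \sum_(i < k) act (T i) (r i) *+ lambda i].

Definition RG_finitely_generated C : Prop :=
  exists (B : set 'cV[R]_n) (G : set 'M[int]_n),
    [/\ finite_set B, B `<=` integer_points C, fg_subgroup_GLZ G &
        RG_generated C B G].

(* The second clause forces r <> 0 when n = 2. *)
Definition closed_half_space_with_boundary_span C (r : 'cV[R]_n) : Prop :=
  exists a : 'rV[R]_n,
    [/\ a <> 0,
        C = [set x | 0 <= (a *m x) 0 0] &
        [set x | (a *m x) 0 0 = 0] = [set c *: r | c in [set: R]]].

End Cones.

(* Main.v *)
(* Part (1): the cone is C = cone(u1, u2).
   If S_C is (R, G)-finitely generated, an element of G either scales u1 and u2 by positive factors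
   or exchanges the two rays. If only the identity does the former, then |G| <= 2 and S_C is a
   finitely generated monoid; since S_C contains points arbitrarily close to either edge, each edge
   must carry a generator, so both rays are rational.
   Conversely, for rational rays this is Gordan's lemma with G trivial. If A scales u1 by
   lambda <> 1, it scales u2 by 1 / lambda, so the cyclic group of A preserves the product of the
   coordinates, and subtracting translates of one integral point p terminates in a bounded set.

   Part (2): for a half-plane, det T plays the role of the distinction between fixing and
   exchanging rays, and the converse follows by cutting the half-plane into cone(r, q) and
   cone(-r, q), where q is integral or the second eigenvector of A. *)
Require Import Defs.
From HB Require Import structures.
From mathcomp Require Import all_boot all_order all_algebra.
From mathcomp Require Import all_classical all_reals.
From mathcomp Require Import ring lra.

Set Implicit Arguments.
Unset Strict Implicit.
Unset Printing Implicit Defensive.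

Import Order.TTheory GRing.Theory Num.Theory.

Local Open Scope classical_set_scope.
Local Open Scope ring_scope.

(** * The linear action, integral vectors, and sums generated by a group *)

Section Action.
Variables (R : realType) (n : nat).
Implicit Types (C B : set 'cV[R]_n) (x y s t : 'cV[R]_n) (A T : 'M[int]_n).
Implicit Types (G X : set 'M[int]_n).

Lemma actD T x y : act T (x + y) = act T x + act T y.
Proof. exact: mulmxDr. Qed.

Lemma actZ T (c : R) x : act T (c *: x) = c *: act T x.
Proof. by rewrite /act scalemxAr. Qed.

Lemma actN T x : act T (- x) = - act T x.
Proof. exact: mulmxN. Qed.

Lemma act1 x : act 1%:M x = x.
Proof. by rewrite /act map_mx1 mul1mx. Qed.

Lemma actM A T x : act (A *m T) x = act A (act T x).
Proof. by rewrite /act map_mxM mulmxA. Qed.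

Lemma GLZ_unit A : GLZ A -> A \in unitmx.
Proof. by rewrite unitmxE; case=> ->. Qed.

Lemma actK T x : GLZ T -> act (invmx T) (act T x) = x.
Proof. by move=> /GLZ_unit TU; rewrite -actM mulVmx // act1. Qed.

Lemma actVK T x : GLZ T -> act T (act (invmx T) x) = x.
Proof. by move=> /GLZ_unit TU; rewrite -actM mulmxV // act1. Qed.

Lemma GLZ_inv A : GLZ A -> GLZ (invmx A).
Proof. by rewrite /GLZ /= det_inv; case=> ->; [left|right]. Qed.

Lemma GLZ_mul A T : GLZ A -> GLZ T -> GLZ (A *m T).
Proof.
by rewrite /GLZ /= det_mulmx; case=> -> [] ->; rewrite ?mul1r ?mulr1 ?mulrNN; tauto.
Qed.

Lemma GLZ_subgroup : subgroup_GLZ (@GLZ n).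
Proof.
by split=> //; [left; rewrite det1|exact: GLZ_mul|exact: GLZ_inv].
Qed.

(** As [GLZ] is itself a subgroup containing [X], the intersection lies in it; closure under
    products and inverses passes to intersections. *)
Lemma subgroup_smallest X : X `<=` @GLZ n ->
  subgroup_GLZ (smallest (@subgroup_GLZ n) X).
Proof.
move=> XG; split.
- exact: smallest_sub GLZ_subgroup XG.
- by move=> G [] [].
- by move=> A T AX TX G GX; case: (GX) => -[_ _ GM _] _; exact: GM (AX G GX) (TX G GX).
- by move=> A AX G GX; case: (GX) => -[_ _ _ GV] _; exact: GV (AX G GX).
Qed.

Definition integral_vec : set 'cV[R]_n :=
  range (fun z : 'cV[int]_n => map_mx intr z).

Lemma act_integral T s : integral_vec s -> integral_vec (act T s).
Proof. by move=> [z _ <-]; exists (T *m z) => //; rewrite map_mxM. Qed.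

Lemma integral_vecD s t : integral_vec s -> integral_vec t -> integral_vec (s + t).
Proof. by move=> [z _ <-] [w _ <-]; exists (z + w) => //; rewrite map_mxD. Qed.

Lemma integral_vecN s : integral_vec s -> integral_vec (- s).
Proof. by move=> [z _ <-]; exists (- z) => //; rewrite map_mxN. Qed.

(** The last clause of [RG_generated] as a predicate of the point, so that sums can be built step by
    step. *)
Definition generated B G s := exists (k : nat) (lambda : 'I_k -> nat)
    (T : 'I_k -> 'M[int]_n) (r : 'I_k -> 'cV[R]_n),
  (forall i, G (T i) /\ B (r i)) /\
  s = \sum_(i < k) act (T i) (r i) *+ lambda i.

Lemma generated0 B G : generated B G 0.
Proof.
exists 0, (fun=> 0), (fun=> 1%:M), (fun=> 0); split; first by case.
by rewrite big_ord0.
Qed.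

Lemma generated1 B G T s : G T -> B s -> generated B G (act T s).
Proof.
move=> GT Bs; exists 1, (fun=> 1), (fun=> T), (fun=> s); split=> //.
by rewrite big_ord1 mulr1n.
Qed.

Lemma generated_mem B G s : G 1%:M -> B s -> generated B G s.
Proof. by move=> G1 Bs; rewrite -(act1 s); exact: generated1. Qed.

Lemma generatedD B G s t :
  generated B G s -> generated B G t -> generated B G (s + t).
Proof.
move=> [k [l [T [r [Tr ->]]]]] [k' [l' [T' [r' [Tr' ->]]]]].
pose f S (g : 'I_k -> S) (h : 'I_k' -> S) (i : 'I_(k + k')%N) :=
  match fintype.split i with inl j => g j | inr j => h j end.
exists (k + k')%N, (f _ l l'), (f _ T T'), (f _ r r'); split.
  by move=> i; rewrite /f; case: fintype.split.
rewrite big_split_ord; congr (_ + _); apply: eq_bigr => i _; rewrite /f.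
  by rewrite (unsplitK (inl i)).
by rewrite (unsplitK (inr i)).
Qed.

Lemma generated_act B G T s : subgroup_GLZ G -> G T ->
  generated B G s -> generated B G (act T s).
Proof.
move=> [_ _ GM _] GT [k [l [T' [r [Tr ->]]]]].
exists k, l, (fun i => T *m T' i), r; split.
  by move=> i; have [? ?] := Tr i; split=> //; exact: GM.
rewrite /act mulmx_sumr; apply: eq_bigr => i _.
by rewrite raddfMn /= map_mxM mulmxA.
Qed.

Lemma generated_sub B B' G s : B `<=` B' -> generated B G s -> generated B' G s.
Proof.
move=> BB' [k [l [T [r [Tr ->]]]]]; exists k, l, T, r; split=> // i.
by have [? ?] := Tr i; split=> //; exact: BB'.
Qed.

(** Stability has to be checked on the generators in [X] only, and generation is asked for every
    subgroup containing [X], so the elements of the smallest one need no description. *)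
Lemma RG_finitely_generated_intro C B X :
  finite_set B -> B `<=` integer_points C -> finite_set X -> X `<=` @GLZ n ->
  (forall T x, X T -> C (act T x) <-> C x) ->
  (forall G s, subgroup_GLZ G -> X `<=` G ->
     integer_points C s -> generated B G s) ->
  RG_finitely_generated C.
Proof.
move=> Bfin BC Xfin XG XC gen.
have sG := subgroup_smallest XG.
have stab T : smallest (@subgroup_GLZ n) X T -> forall x, C (act T x) -> C x.
  (* With an equivalence instead of an implication, this stabilizer is closed under inverses. *)
  set D := [set T | GLZ T /\ forall x, C (act T x) <-> C x].
  suff /smallest_sub : subgroup_GLZ D.
    by move=> /(_ X) XD /XD[|_ /[swap] x /(_ x)[]//] S XS; split; [exact: XG|move=> x; exact: XC].
  split=> [S []//||S S' [GS CS] [GS' CS']|S [GS CS]].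
  - by split=> [|x]; [case: GLZ_subgroup|rewrite act1].
  - by split=> [|x]; [exact: GLZ_mul|rewrite actM CS CS'].
  - by split=> [|x]; [exact: GLZ_inv|rewrite -CS actVK].
have stabV T x : smallest (@subgroup_GLZ n) X T -> C x -> C (act T x).
  case: sG => sub _ _ sV ST Cx; apply: (stab _ (sV _ ST)).
  by rewrite actK //; exact: sub.
exists B, (smallest (@subgroup_GLZ n) X); split=> //; first by exists X.
have [_ s1 _ _] := sG.
split.
- apply/seteqP; split=> [_ [T ST [x Cx <-]]|x Cx]; first exact: stabV.
  by exists 1%:M => //; exists x => //; rewrite act1.
- apply/seteqP; split=> [_ [T ST [x [Cx xz] <-]]|x Cx].
    by split; [exact: stabV|exact: act_integral].
  by exists 1%:M => //; exists x => //; rewrite act1.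
- by move=> s; apply: gen => //; exact: sub_gen_smallest.
Qed.

End Action.

(** * Two finiteness criteria *)

(** Each entry is encoded by a sign and a natural number below a fixed bound, and there are finitely
    many vectors of such pairs. *)
Lemma finite_bounded_integral (R : realType) (n : nat) (M : R) :
  finite_set [set x : 'cV[R]_n | integral_vec x /\ forall i, `|x i 0| <= M].
Proof.
pose N := (Num.trunc M).+1.
pose f (e : bool * 'I_N) : R := ((-1) ^+ e.1 * (e.2 : nat)%:Z)%:~R.
suff sub : [set x : 'cV[R]_n | integral_vec x /\ forall i, `|x i 0| <= M] `<=`
    (fun w : 'cV_n => map_mx f w) @` setT.
  by apply: sub_finite_set sub _; apply: finite_image; exact: finite_finset.
move=> _ [[z _ <-] zM].
exists (\col_i ((z i 0 < 0)%R, inord (absz (z i 0)))) => //.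
apply/matrixP => i j; rewrite (ord1 j) !mxE /f /= inordK.
  by rewrite abszE -numEsign.
rewrite -(ltr_nat R); apply: le_lt_trans (truncnS_gt M).
by have := zM i; rewrite mxE -intr_norm -abszE.
Qed.

(** [P] acts as a subgroup of index at most two. For [T], [S] in [G] outside [P], both [T *m S] and
    [S *m S] lie in [P], hence equal 1, so [T = S]. *)
Lemma finite_subgroup_index2 (n : nat) (G P : set 'M[int]_n) : subgroup_GLZ G ->
  (forall T, G T -> P T -> T = 1%:M) ->
  (forall T T', G T -> G T' -> ~ P T -> ~ P T' -> P (T *m T')) ->
  finite_set G.
Proof.
move=> [GG G1 GM GV] P1 PM.
have [[S [GS PS]]|noS] := pselect (exists S, G S /\ ~ P S); last first.
  apply: (sub_finite_set _ (finite_set1 (1%:M : 'M[int]_n))) => T GT /=.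
  by apply: P1 => //; apply: contrapT => PT; apply: noS; exists T.
apply: (sub_finite_set _ (finite_set2 (1%:M : 'M[int]_n) S)) => T GT /=.
have [/P1->//|PT] := pselect (P T); first by left.
right; have US := GLZ_unit (GG _ GS).
rewrite -(mulmxK US T) (P1 _ (GM _ _ GT GS) (PM _ _ GT GS PT PS)).
by rewrite -(P1 _ (GM _ _ GS GS) (PM _ _ GS GS PS PS)) mulmxK.
Qed.

(** * Coordinates in the plane *)

Section Plane.
Variable R : realType.
Implicit Types (u v x y s t r q : 'cV[R]_2) (A T : 'M[int]_2).
Implicit Types (B C F : set 'cV[R]_2) (G : set 'M[int]_2).

Lemma cV2P x y : x 0 0 = y 0 0 -> x 1 0 = y 1 0 -> x = y.
Proof.
move=> e0 e1; apply/matrixP => i j; rewrite (ord1 j).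
by case: i => -[|[|//]] lti; [move: e0|move: e1];
  congr (_ = _); congr (fun_of_matrix _ _ _); exact/val_inj.
Qed.

Lemma act_mxE A x i : act A x i 0 = (A i 0)%:~R * x 0 0 + (A i 1)%:~R * x 1 0.
Proof.
rewrite /act mxE !big_ord_recl big_ord0 addr0 !mxE.
by have -> : lift ord0 ord0 = 1 :> 'I_2 by exact/val_inj.
Qed.

Lemma det2 A : \det A = A 0 0 * A 1 1 - A 0 1 * A 1 0.
Proof.
rewrite (expand_det_row _ 0) !big_ord_recl big_ord0 addr0 /cofactor !det_mx11 !mxE.
rewrite /= !expr0 !mul1r expr1 mulN1r mulrN.
have -> : lift 0 0 = 1 :> 'I_2 by exact/val_inj.
by have -> : lift 1 0 = 0 :> 'I_2 by exact/val_inj.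
Qed.

(** The determinant with columns [x], [y]. By Cramer's rule the coordinates of [x] in a basis [u],
    [v] are [cross x v / cross u v] and [cross u x / cross u v]; coordinate conditions below take
    this form. *)
Definition cross x y : R := x 0 0 * y 1 0 - x 1 0 * y 0 0.

Lemma crossxx x : cross x x = 0.
Proof. by rewrite /cross; ring. Qed.

Lemma crossC x y : cross y x = - cross x y.
Proof. by rewrite /cross; ring. Qed.

Lemma crossDl x y s : cross (x + y) s = cross x s + cross y s.
Proof. by rewrite /cross !mxE; ring. Qed.

Lemma crossDr x y s : cross s (x + y) = cross s x + cross s y.
Proof. by rewrite /cross !mxE; ring. Qed.

Lemma crossZl (c : R) x y : cross (c *: x) y = c * cross x y.
Proof. by rewrite /cross !mxE; ring. Qed.

Lemma crossZr (c : R) x y : cross x (c *: y) = c * cross x y.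
Proof. by rewrite /cross !mxE; ring. Qed.

Lemma cross0l x : cross 0 x = 0.
Proof. by rewrite /cross !mxE !mul0r subr0. Qed.

Lemma cross0r x : cross x 0 = 0.
Proof. by rewrite /cross !mxE !mulr0 subr0. Qed.

Definition crossE := (crossDl, crossDr, crossZl, crossZr, crossxx).

Lemma cross_act A x y :
  cross (act A x) (act A y) = (\det A)%:~R * cross x y.
Proof. by rewrite /cross !act_mxE det2 rmorphB !rmorphM /=; ring. Qed.

Lemma cross_basis u v x : cross u v != 0 ->
  x = (cross x v / cross u v) *: u + (cross u x / cross u v) *: v.
Proof. by rewrite /cross => uv; apply: cV2P; rewrite !mxE; field. Qed.

Lemma cross_inj u v (a b a' b' : R) : cross u v != 0 ->
  a *: u + b *: v = a' *: u + b' *: v -> a = a' /\ b = b'.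
Proof.
move=> uv e; have := congr1 (cross^~ v) e; have := congr1 (cross u) e.
rewrite !crossE !mulr0 !addr0 !add0r => /(mulIf uv) -> /(mulIf uv) -> //.
Qed.

Lemma cross_neq0l u v : cross u v != 0 -> u != 0.
Proof. by apply: contraNneq => ->; rewrite cross0l. Qed.

Lemma cross_neq0r u v : cross u v != 0 -> v != 0.
Proof. by apply: contraNneq => ->; rewrite cross0r. Qed.

Lemma cross_eq0_collinear u x : u != 0 -> cross u x = 0 -> exists c, x = c *: u.
Proof.
move=> u0 /eqP; rewrite subr_eq0 => /eqP ux.
have [u00|u00] := eqVneq (u 0 0) 0; last first.
  exists (x 0 0 / u 0 0); apply: cV2P; rewrite !mxE; first by field.
  by rewrite -(mulKf u00 (x 1 0)) ux; field.
have u10 : u 1 0 != 0.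
  by apply: contra_neq u0 => u10; apply: cV2P; rewrite !mxE.
exists (x 1 0 / u 1 0); apply: cV2P; rewrite !mxE; last by field.
by rewrite -(mulKf u10 (x 0 0)) -ux; field.
Qed.

Lemma act_inv_eigen A u (a : R) : GLZ A -> a != 0 -> act A u = a *: u ->
  act (invmx A) u = a^-1 *: u.
Proof.
by move=> GA a0 Au; rewrite -{2}(actK u GA) Au actZ scalerA mulVf // scale1r.
Qed.

(** * Cones spanned by two vectors, and Gordan's lemma *)

Definition cone u v : set 'cV[R]_2 :=
  [set x | exists a b : R, [/\ 0 <= a, 0 <= b & x = a *: u + b *: v]].

Lemma coneC u v : cone u v = cone v u.
Proof.
by apply/seteqP; split=> x [a [b [a0 b0 ->]]]; exists b, a; rewrite addrC.
Qed.

Lemma coneZ u v (c d : R) : 0 < c -> 0 < d -> cone (c *: u) (d *: v) = cone u v.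
Proof.
move=> c0 d0; apply/seteqP; split=> x [a [b [a0 b0 ->]]].
  by exists (a * c), (b * d); rewrite !scalerA !mulr_ge0 // ltW.
exists (a / c), (b / d).
by rewrite !scalerA !divfK ?gt_eqF // !divr_ge0 // ltW.
Qed.

Lemma cone_left u v : cone u v u.
Proof. by exists 1, 0; rewrite scale1r scale0r addr0. Qed.

Lemma cone_right u v : cone u v v.
Proof. by exists 0, 1; rewrite scale1r scale0r add0r. Qed.

Lemma finite_parallelogram u v (M : R) :
  finite_set [set x | integral_vec x /\
    exists a b : R, [/\ 0 <= a <= M, 0 <= b <= M & x = a *: u + b *: v]].
Proof.
pose K := M * (`|u 0 0| + `|u 1 0| + `|v 0 0| + `|v 1 0|).
apply: sub_finite_set (finite_bounded_integral 2 K).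
move=> x [xz [a [b [/andP[a0 aM] /andP[b0 bM] xE]]]]; split=> // i; rewrite xE.
rewrite !mxE (le_trans (ler_normD _ _)) // !normrM (ger0_norm a0) (ger0_norm b0).
have le : `|u i 0| <= `|u 0 0| + `|u 1 0| /\ `|v i 0| <= `|v 0 0| + `|v 1 0|.
  have [->|->] : i = 0 \/ i = 1; first last; rewrite ?lerDl ?lerDr //.
  by case: i => -[|[|//]] lti; [left|right]; exact/val_inj.
have M0 : 0 <= M := le_trans a0 aM.
have [leu lev] := le.
rewrite /K -!addrA [X in _ <= M * X]addrA mulrDr lerD //.
  by rewrite (le_trans (ler_wpM2r _ aM)) // ler_wpM2l.
by rewrite (le_trans (ler_wpM2r _ bM)) // ler_wpM2l.
Qed.

(* The remainders [s - floor a u - floor b v] of [s = a u + b v] lie in the unit parallelogram. *)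
Lemma gordan u v : cross u v != 0 -> integral_vec u -> integral_vec v ->
  exists B : set 'cV[R]_2, [/\ finite_set B, B `<=` integer_points (cone u v) &
    forall G s, subgroup_GLZ G -> integer_points (cone u v) s -> generated B G s].
Proof.
move=> uv uz vz.
pose P := [set x | integral_vec x /\
    exists a b : R, [/\ 0 <= a <= 1, 0 <= b <= 1 & x = a *: u + b *: v]].
exists ([set u; v] `|` P); split.
- by rewrite finite_setU; split; [exact: finite_set2|exact: finite_parallelogram].
- move=> x [[->|->]|[xz [a [b [/andP[a0 _] /andP[b0 _] xE]]]]].
  + by split; [exact: cone_left|].
  + by split; [exact: cone_right|].
  + by split=> //; exists a, b.
move=> G s [_ G1 _ _] [[a [b [a0 b0 ->]]]].
(* Induction on a bound for [a + b], which drops by 1 whenever [u] or [v] is subtracted. *)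
have [N] : exists N : nat, a + b < N%:R by exists (Num.trunc (a + b)).+1; exact: truncnS_gt.
elim: N a b a0 b0 => [|N IH] a b a0 b0 abN sz.
  by move: abN; rewrite mulr0n; lra.
have [a1|a1] := lerP 1 a.
  have -> : a *: u + b *: v = u + ((a - 1) *: u + b *: v).
    by apply: cV2P; rewrite !mxE; ring.
  apply: generatedD; first by apply: generated_mem => //; left; left.
  apply: IH => //; [lra|by move: abN; rewrite -natr1; lra|].
  have -> : (a - 1) *: u + b *: v = (a *: u + b *: v) - u.
    by apply: cV2P; rewrite !mxE; ring.
  by apply: integral_vecD => //; exact: integral_vecN.
have [b1|b1] := lerP 1 b.
  have -> : a *: u + b *: v = v + (a *: u + (b - 1) *: v).
    by apply: cV2P; rewrite !mxE; ring.
  apply: generatedD; first by apply: generated_mem => //; left; right.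
  apply: IH => //; [lra|by move: abN; rewrite -natr1; lra|].
  have -> : a *: u + (b - 1) *: v = (a *: u + b *: v) - v.
    by apply: cV2P; rewrite !mxE; ring.
  by apply: integral_vecD => //; exact: integral_vecN.
apply: generated_mem => //; right; split=> //; exists a, b; split=> //.
  by rewrite a0 ltW.
by rewrite b0 ltW.
Qed.

(** * Generation under a hyperbolic matrix *)

(** Bernoulli's inequality. *)
Lemma expr_unbounded (L x : R) : 1 < L -> exists k, x < L ^+ k.
Proof.
move=> L1; pose k := (Num.trunc (x / (L - 1))).+1.
have bern m : 1 + m%:R * (L - 1) <= L ^+ m.
  elim: m => [|m IH]; first by rewrite mul0r addr0 expr0.
  have m0 : (0 : R) <= m%:R by [].
  rewrite exprS -natr1; apply: le_trans (ler_wpM2l _ IH); last lra.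
  by have := mulr_ge0 m0 (sqr_ge0 (L - 1)); nra.
exists k; apply: lt_le_trans (bern k).
have : x / (L - 1) < k%:R := truncnS_gt _.
by rewrite ltr_pdivrMr ?subr_gt0 //; lra.
Qed.

(** Infinite descent: the sum of absolute values of the entries of an integral vector is a natural
    number, and [act A x] is again an integral eigenvector, with this number multiplied by [mu]. *)
Lemma contracted_integral_vec A (mu : R) x : 0 < mu < 1 -> integral_vec x ->
  act A x = mu *: x -> x = 0.
Proof.
move=> /andP[mu0 mu1].
pose N y : R := `|y 0 0| + `|y 1 0|.
have N0 y : N y = 0 -> y = 0.
  move=> /eqP; rewrite paddr_eq0 // !normr_eq0 => /andP[/eqP y0 /eqP y1].
  by apply: cV2P; rewrite mxE.
have Nnat y : integral_vec y -> exists m : nat, N y = m%:R.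
  move=> [z _ <-]; exists (absz (z 0%R 0%R) + absz (z 1%R 0%R))%N.
  by rewrite /N !mxE natrD -!intr_norm -!abszE.
have [n] : exists n : nat, N x < n%:R.
  by exists (Num.trunc (N x)).+1; exact: truncnS_gt.
elim: n x => [|n IH] x Nn xz xE.
  by move: Nn; rewrite mulr0n ltNge addr_ge0.
have [/N0//|x0] := eqVneq (N x) 0.
have Nx : 0 < N x by rewrite lt_def x0 addr_ge0.
suff /eqP : mu *: x = 0 by rewrite scaler_eq0 gt_eqF //= => /eqP.
apply: IH; last 2 first.
- by rewrite -xE; exact: act_integral.
- by rewrite actZ xE.
have -> : N (mu *: x) = mu * N x.
  by rewrite /N !mxE !normrM gtr0_norm // mulrDr.
have [m Nm] := Nnat _ xz.
have mn : m%:R <= n%:R :> R by rewrite ler_nat -ltnS -(ltr_nat R) -Nm.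
by rewrite (lt_le_trans _ mn) // -Nm; nra.
Qed.

(* Translates of a fixed nonzero integral point [p = a0 u + b0 v] are subtracted from
   [s = a u + b v]; this decreases the product [a b], which [A] preserves, while powers of [A]
   bring the slope of [s] next to that of [p]. *)
Lemma hyperbolic_generation u v A (lam : R) :
  cross u v != 0 -> GLZ A -> 1 < lam ->
  act A u = lam *: u -> act A v = lam^-1 *: v ->
  exists B : set 'cV[R]_2, [/\ finite_set B, B `<=` integer_points (cone u v) &
    forall G s, subgroup_GLZ G -> G A ->
      integer_points (cone u v) s -> generated B G s].
Proof.
move=> uv GA lam1 Au Av.
have lam0 : 0 < lam by rewrite (lt_trans _ lam1).
have lamN0 : lam != 0 by rewrite gt_eqF.
have lamV : 0 < lam^-1 < 1 by rewrite invr_gt0 lam0 invf_lt1.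
have VAu := act_inv_eigen GA lamN0 Au.
have VAv : act (invmx A) v = lam *: v.
  by rewrite (act_inv_eigen GA _ Av) ?invrK // invr_eq0.
have AE a b : act A (a *: u + b *: v) = (a * lam) *: u + (b / lam) *: v.
  by rewrite actD !actZ Au Av !scalerA.
have VAE a b : act (invmx A) (a *: u + b *: v) = (a / lam) *: u + (b * lam) *: v.
  by rewrite actD !actZ VAu VAv !scalerA.
(* No nonzero integral point lies on an edge: [A] contracts the edge of [v], and its inverse that of
   [u]. *)
have inner (a b : R) : 0 <= a -> 0 <= b -> integral_vec (a *: u + b *: v) ->
    a *: u + b *: v != 0 -> 0 < a /\ 0 < b.
  move=> a0 b0 sz s0; rewrite !lt_def a0 b0 !andbT; split; apply: contra_neq s0.
    move=> aE; move: sz; rewrite aE scale0r add0r => sz.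
    by apply: (contracted_integral_vec (A := A) lamV) => //; rewrite actZ Av !scalerA mulrC.
  move=> bE; move: sz; rewrite bE scale0r addr0 => sz.
  apply: (contracted_integral_vec (A := invmx A) lamV) => //.
  by rewrite actZ VAu !scalerA mulrC.
have [[p [[[a0 [b0 [a00 b00 pE]]] pz] pN0]]|noP] :=
  pselect (exists p, integer_points (cone u v) p /\ p != 0); last first.
  exists set0; split=> // G s _ _ sC.
  have [->|s0] := eqVneq s 0; first exact: generated0.
  by case: noP; exists s.
rewrite pE in pz pN0; have {a00 b00} [a00 b00] := inner _ _ a00 b00 pz pN0.
(* [A] multiplies the ratio of the two coordinates by [L]. *)
pose L := lam ^+ 2; have L1 : 1 < L by rewrite exprn_egt1.
(* A point whose coordinate ratio is between that of [p] and [L] times it, and from which [p] cannot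
   be subtracted, has coordinates below [L * a0] and [b0], hence both below [M]. *)
pose M := L * a0 + b0.
pose P := [set x | integral_vec x /\
    exists a b : R, [/\ 0 <= a <= M, 0 <= b <= M & x = a *: u + b *: v]].
exists (p |` P); split.
- by rewrite finite_setU; split; [exact: finite_set1|exact: finite_parallelogram].
- move=> x [->|[xz [a [b [/andP[? _] /andP[? _] xE]]]]].
    by rewrite pE; split=> //; exists a0, b0; split=> //; exact: ltW.
  by split=> //; exists a, b.
move=> G s sG GA' [[a [b [a_ge0 b_ge0 sE]]] sz].
have [_ G1 _ GV] := sG.
pose Q a b := generated (p |` P) G (a *: u + b *: v).
have QA (x y : R) : Q (x * lam) (y / lam) -> Q x y.
  by rewrite /Q -AE => /(generated_act sG (GV _ GA')); rewrite actK.
have QVA (x y : R) : Q (x / lam) (y * lam) -> Q x y.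
  by rewrite /Q -VAE => /(generated_act sG GA'); rewrite actVK.
(* Induction on [n]: subtracting [p] inside the cone lowers the product of the coordinates by at
   least [a0 * b0]. *)
have [n] : exists n : nat, a * b < n%:R * (a0 * b0).
  exists (Num.trunc (a * b / (a0 * b0))).+1.
  by rewrite -ltr_pdivrMr ?mulr_gt0 //; exact: truncnS_gt.
rewrite sE in sz *; rewrite -/(Q a b).
elim: n a b a_ge0 b_ge0 sz {sE} => [|n IH] a b a_ge0 b_ge0 sz abn.
  by move: abn; rewrite mul0r ltNge mulr_ge0.
have [s0|s0] := eqVneq (a *: u + b *: v) 0.
  by rewrite /Q s0; exact: generated0.
have {a_ge0 b_ge0 s0} [a_gt0 b_gt0] := inner _ _ a_ge0 b_ge0 sz s0.
have near (x y : R) : 0 < x -> 0 < y -> integral_vec (x *: u + y *: v) ->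
    x * y < n.+1%:R * (a0 * b0) -> y * a0 <= x * b0 < L * (y * a0) -> Q x y.
  move=> x0 y0 xyz xyn /andP[lo hi].
  have inbox : x <= M -> y <= M -> Q x y.
    move=> xM yM; apply: generated_mem => //; right; split=> //.
    by exists x, y; rewrite xM yM !ltW.
  have La0 : 0 < L * a0 by rewrite mulr_gt0 // (lt_trans _ L1).
  have a0L : a0 < L * a0 by rewrite ltr_pMl.
  rewrite /M in inbox.
  have [ax|xa] := lerP a0 x; have [by_|yb] := lerP b0 y.
  - have -> : Q x y = generated (p |` P) G (p + ((x - a0) *: u + (y - b0) *: v)).
      by rewrite /Q; congr generated; rewrite pE; apply: cV2P; rewrite !mxE; ring.
    apply: generatedD; first by apply: generated_mem => //; left.
    apply: IH; rewrite ?subr_ge0 //.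
      have -> : (x - a0) *: u + (y - b0) *: v = (x *: u + y *: v) - (a0 *: u + b0 *: v).
        by apply: cV2P; rewrite !mxE; ring.
      by apply: integral_vecD => //; exact: integral_vecN.
    by move: xyn; rewrite -natr1; nra.
  - have xL : x < L * a0.
      by rewrite -(ltr_pM2r b00) (lt_trans hi) // mulrCA [ltRHS]mulrC ltr_pM2r.
    by apply: inbox => //; lra.
  - have yb : y < b0.
      by rewrite -(ltr_pM2r a00) (le_lt_trans lo) // mulrC ltr_pM2l.
    by apply: inbox => //; lra.
  - by apply: inbox => //; lra.
have LE : L = lam * lam by rewrite /L expr2.
(* If the ratio [x / y] is too large, the inverse of [A] divides it by [L] until [near] applies; the
   product [x * y] is unchanged. *)
have up k (x y : R) : 0 < x -> 0 < y -> integral_vec (x *: u + y *: v) ->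
    x * y < n.+1%:R * (a0 * b0) -> y * a0 <= x * b0 < L ^+ k * (y * a0) -> Q x y.
  elim: k x y => [|k IHk] x y x0 y0 xyz xyn /andP[lo hi].
    by move: hi; rewrite expr0 mul1r ltNge lo.
  have [hi'|lo'] := ltrP (x * b0) (L * (y * a0)); first by apply: near => //; rewrite lo.
  apply: QVA; apply: IHk; rewrite ?divr_gt0 ?mulr_gt0 //.
  - by rewrite -VAE; exact: act_integral.
  - by rewrite mulrACA mulVf // mulr1.
  - rewrite -(ler_pM2l lam0) -(ltr_pM2l lam0).
    have -> : lam * (x / lam * b0) = x * b0 by field.
    apply/andP; split.
      by apply: le_trans lo'; rewrite LE le_eqVlt; apply/orP; left; apply/eqP; ring.
    by apply: (lt_le_trans hi); rewrite exprS {1}LE le_eqVlt; apply/orP; left; apply/eqP; ring.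
(* If the ratio is too small, [A] multiplies it by [L] until it reaches that of [p]; then [up] takes
   over. *)
have down k (x y : R) : 0 < x -> 0 < y -> integral_vec (x *: u + y *: v) ->
    x * y < n.+1%:R * (a0 * b0) -> y * a0 <= L ^+ k * (x * b0) -> Q x y.
  elim: k x y => [|k IHk] x y x0 y0 xyz xyn lo.
    have [k] := expr_unbounded (x * b0 / (y * a0)) L1.
    rewrite ltr_pdivrMr ?mulr_gt0 // => hi.
    by apply: (up k) => //; rewrite hi andbT -[leRHS]mul1r -(expr0 L).
  apply: QA; apply: IHk; rewrite ?divr_gt0 ?mulr_gt0 //.
  - by rewrite -AE; exact: act_integral.
  - by rewrite mulrACA mulfV // mulr1.
  - rewrite -(ler_pM2l lam0).
    have -> : lam * (y / lam * a0) = y * a0 by field.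
    by apply: (le_trans lo); rewrite exprS {1}LE le_eqVlt; apply/orP; left; apply/eqP; ring.
have [k] := expr_unbounded (b * a0 / (a * b0)) L1.
by rewrite ltr_pdivrMr ?mulr_gt0 // => /ltW; exact: down.
Qed.

(** Both sides are the factor by which [A] scales the signed area spanned by [u] and [v]. *)
Lemma eigen_det A u v (a b : R) : cross u v != 0 ->
  act A u = a *: u -> act A v = b *: v -> a * b = (\det A)%:~R.
Proof.
move=> uv Au Av; apply: (mulIf uv).
by rewrite -cross_act Au Av !crossE mulrA.
Qed.

Lemma act_fix_basis A u v : cross u v != 0 -> act A u = u -> act A v = v -> A = 1%:M.
Proof.
move=> uv Au Av; have fix_ x : act A x = x.
  by rewrite (cross_basis x uv) actD !actZ Au Av.
apply/matrixP => i j; apply: (@intr_inj R).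
have := congr1 (fun y : 'cV[R]_2 => y i 0) (fix_ (delta_mx j 0)).
by rewrite /act -colE !mxE eqxx andbT => ->; case: eqP.
Qed.

(** For [lam < 1] the roles of [u] and [v] are exchanged, as the eigenvalue of [v] then exceeds
    1. *)
Lemma hyperbolic_generation_neq1 u v A (lam : R) :
  cross u v != 0 -> GLZ A -> 0 < lam -> lam != 1 ->
  act A u = lam *: u -> act A v = lam^-1 *: v ->
  exists B : set 'cV[R]_2, [/\ finite_set B, B `<=` integer_points (cone u v) &
    forall G s, subgroup_GLZ G -> G A ->
      integer_points (cone u v) s -> generated B G s].
Proof.
move=> uv GA lam0 lamN1 Au Av; have [lam1|lam1|lam1] := ltgtP lam 1.
- rewrite coneC; apply: (@hyperbolic_generation v u A lam^-1) => //.
  + by rewrite crossC oppr_eq0.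
  + by rewrite invf_gt1.
  + by rewrite invrK.
- exact: hyperbolic_generation lam1 Au Av.
- by rewrite lam1 eqxx in lamN1.
Qed.

Lemma cone_act u v A (a b : R) x : 0 <= a -> 0 <= b ->
  act A u = a *: u -> act A v = b *: v -> cone u v x -> cone u v (act A x).
Proof.
move=> a0 b0 Au Av [c [d [c0 d0 ->]]]; exists (c * a), (d * b).
by rewrite actD !actZ Au Av !scalerA !mulr_ge0.
Qed.

Lemma cone_act_iff u v A (a b : R) x : GLZ A -> 0 < a -> 0 < b ->
  act A u = a *: u -> act A v = b *: v -> cone u v (act A x) <-> cone u v x.
Proof.
move=> GA a0 b0 Au Av; split; last by apply: cone_act Au Av; exact: ltW.
have Vu := act_inv_eigen GA (lt0r_neq0 a0) Au.
have Vv := act_inv_eigen GA (lt0r_neq0 b0) Av.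
move=> /(cone_act _ _ Vu Vv); rewrite actK // invr_ge0 ltW // invr_ge0 ltW //.
by apply.
Qed.

(** * Rationality of rays and lines *)

(** The common form of [rational_ray] and [rational_direction]; they agree because the opposite of
    an integral vector is integral. *)
Definition integral_multiple u :=
  exists x (c : R), [/\ integral_vec x, 0 < c & x = c *: u].

Lemma integral_multiple_neq0 u x (c : R) :
  integral_vec x -> c != 0 -> x = c *: u -> integral_multiple u.
Proof.
move=> xz c0 xE; have [c_lt0|c_gt0|/eqP] := ltgtP c 0; last by rewrite (negPf c0).
  exists (- x), (- c); split; [exact: integral_vecN|by rewrite oppr_gt0|].
  by rewrite xE scaleNr.
by exists x, c.
Qed.

(** Multiplication by the product of the two denominators clears both. *)
Lemma integral_multiple_rat (w : 'cV[rat]_2) :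
  integral_multiple (map_mx ratr w : 'cV[R]_2).
Proof.
pose z : 'cV[int]_2 := \col_i (if i == 0 then numq (w 0 0) * denq (w 1 0)
                               else numq (w 1 0) * denq (w 0 0)).
exists (map_mx intr z), (denq (w 0 0) * denq (w 1 0))%:~R; split.
- by exists z.
- by rewrite ltr0z mulr_gt0.
have d0 i : (denq (w i 0))%:~R != 0 :> R by rewrite intr_eq0 denq_neq0.
have cancel (a b c : R) : b != 0 -> a * c = b * c * (a / b) by move=> ?; field.
apply: cV2P; rewrite !mxE /= /ratr !rmorphM /=; first exact: cancel.
by rewrite [(denq (w 0 0))%:~R * _]mulrC; exact: cancel.
Qed.

Lemma integral_multipleZ u (c : R) : c != 0 ->
  integral_multiple (c *: u) -> integral_multiple u.
Proof.
move=> c0 [x [d [xz d0 xE]]]; apply: (integral_multiple_neq0 (c := d * c) xz).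
  by rewrite mulf_neq0 // gt_eqF.
by rewrite -scalerA.
Qed.

Lemma ray_self u : ray u u.
Proof. by exists 1; [exact: ltr01|rewrite scale1r]. Qed.

Lemma ray_scale u (c : R) : 0 < c -> ray (c *: u) = ray u.
Proof.
move=> c0; apply/seteqP; split=> _ [d /= d0 <-].
  by exists (d * c); [exact: mulr_gt0|rewrite scalerA].
by exists (d / c); [exact: divr_gt0|rewrite scalerA divfK // gt_eqF].
Qed.

Lemma map_ratr_intr (z : 'cV[int]_2) :
  map_mx ratr (map_mx intr z : 'cV[rat]_2) = map_mx intr z :> 'cV[R]_2.
Proof. by apply/matrixP => i j; rewrite !mxE ratr_int. Qed.

Lemma rational_rayP u : rational_ray u <-> integral_multiple u.
Proof.
split=> [[w uw]|[x [c [[z _ <-] c0 zE]]]].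
  have [c /= c0 wu] : ray u (map_mx ratr w) by rewrite uw; exact: ray_self.
  apply: (integral_multipleZ (lt0r_neq0 c0)); rewrite wu.
  exact: integral_multiple_rat.
by exists (map_mx intr z); rewrite map_ratr_intr zE ray_scale.
Qed.

Lemma rational_directionP u : rational_direction u <-> integral_multiple u.
Proof.
split=> [[c [w [/eqP c0 ->]]]|[x [c [[z _ <-] c0 zE]]]].
  apply: (integral_multipleZ (c := c^-1)); first by rewrite invr_eq0.
  by rewrite scalerA mulVf // scale1r; exact: integral_multiple_rat.
exists c^-1, (map_mx intr z); split; first by apply/eqP; rewrite invr_eq0 gt_eqF.
by rewrite map_ratr_intr zE scalerA mulVf ?scale1r // gt_eqF.
Qed.

(** A nonzero row of [A - 1%:M] annihilates [r]; turned by a right angle, it is a nonzero integral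
    vector parallel to [r]. *)
Lemma fixed_integral_multiple A r : A <> 1%:M -> r != 0 -> act A r = r ->
  integral_multiple r.
Proof.
move=> AN1 r0 Ar; have /matrix0Pn[i [j Dij]] : A - 1%:M != 0.
  by rewrite subr_eq0; exact/eqP.
have Dr : act (A - 1%:M) r = 0.
  by rewrite /act map_mxB mulmxBl -/(act A r) -/(act 1%:M r) act1 Ar subrr.
set D := A - 1%:M in Dij Dr.
pose z : 'cV[int]_2 := \col_k (if k == 0 then - D i 1 else D i 0).
have /(cross_eq0_collinear r0)[c zE] : cross r (map_mx intr z) = 0.
  have := congr1 (fun y : 'cV[R]_2 => y i 0) Dr.
  by rewrite act_mxE /cross !mxE /= rmorphN => <-; ring.
apply: (integral_multiple_neq0 _ _ zE); first by exists z.
apply: contraNneq Dij => c0; move: zE; rewrite c0 scale0r => z0.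
have D0 : D i 1 = 0.
  apply: (@intr_inj R); have := congr1 (fun y : 'cV[R]_2 => - y 0 0) z0.
  by rewrite !mxE /= rmorphN opprK oppr0.
have D1 : D i 0 = 0.
  apply: (@intr_inj R); have := congr1 (fun y : 'cV[R]_2 => y 1 0) z0.
  by rewrite !mxE.
have [->|->] : j = 0 \/ j = 1; rewrite ?D0 ?D1 //.
by case: j => -[|[|//]] ltj; [left|right]; exact/val_inj.
Qed.

(** * Finite generation forces rational edges *)

(** Rounding the entries of a point changes its coordinates along [u] and [v] by at most a constant
    [K], which is harmless for a point of the sector far from the origin. *)
Lemma integral_near_ray u v (c : R) : cross u v != 0 -> 0 < c ->
  exists a b : R, [/\ 0 < a, 0 <= b, b < c * a & integral_vec (a *: u + b *: v)].
Proof.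
move=> uv c0.
pose W := `|cross u v|; have W0 : 0 < W by rewrite normr_gt0.
pose K := (`|u 0 0| + `|u 1 0| + `|v 0 0| + `|v 1 0|) / W.
have K0 : 0 <= K by rewrite divr_ge0 ?addr_ge0 // ltW.
pose e := K / c; have e0 : 0 <= e by rewrite divr_ge0 // ltW.
have eK : c * e = K by rewrite /e mulrC divfK // gt_eqF.
(* This gives [t > K], [t * c / 2 >= K] and [t * c / 2 > K + c * K], so the coordinates [t] and
   [t * c / 2] still satisfy the three inequalities after errors up to [K]. *)
pose t := 2 * e + 2 * K + 1.
pose y := t *: u + (t * c / 2) *: v.
pose z : 'cV[int]_2 := \col_i Num.floor (y i 0).
pose d := map_mx intr z - y.
have d1 i : `|d i 0| <= 1.
  rewrite !mxE; have /andP[lo] := floor_itv (y i 0); rewrite rmorphD /= => hi.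
  by move: lo hi; rewrite !mxE => lo hi; rewrite ler_norml; apply/andP; split; lra.
have dom x : `|x 0 0| + `|x 1 0| <= W * K -> `|cross d x| / W <= K.
  move=> xK; rewrite ler_pdivrMr // mulrC (le_trans _ xK) //.
  rewrite (le_trans (ler_normB _ _)) // !normrM addrC.
  have := d1 0; have := d1 1; have := normr_ge0 (x 0 0); have := normr_ge0 (x 1 0).
  by have := normr_ge0 (d 0 0); have := normr_ge0 (d 1 0); nra.
have WK : W * K = `|u 0 0| + `|u 1 0| + `|v 0 0| + `|v 1 0|.
  by rewrite /K mulrC divfK // gt_eqF.
have ha : `|cross d v / cross u v| <= K.
  rewrite normf_div dom // WK.
  by have := normr_ge0 (u 0 0); have := normr_ge0 (u 1 0); lra.
have hb : `|cross u d / cross u v| <= K.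
  rewrite crossC mulNr normrN normf_div dom // WK.
  by have := normr_ge0 (v 0 0); have := normr_ge0 (v 1 0); lra.
exists (t + cross d v / cross u v), (t * c / 2 + cross u d / cross u v).
move: ha hb; set a := cross d v / _; set b := cross u d / _.
rewrite !ler_norml => /andP[a1 a2] /andP[b1 b2]; split.
- by rewrite /t; lra.
- by rewrite /t; nra.
- by rewrite /t; nra.
have -> : (t + a) *: u + (t * c / 2 + b) *: v = map_mx intr z.
  rewrite -[RHS](subrK y) -/d (cross_basis d uv) -/a -/b /y.
  by apply: cV2P; rewrite !mxE; ring.
by exists z.
Qed.

Lemma finite_slope_bound u v F : finite_set F ->
  (forall f, F f -> f = 0 \/ 0 < cross u f / cross u v) ->
  exists2 c : R, 0 < c &
    forall f, F f -> c * (cross f v / cross u v) <= cross u f / cross u v.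
Proof.
move=> /finite_seqP[l ->]; elim: l => [|f l IH] Hf; first by exists 1.
have [c c0 Hc] : exists2 c : R, 0 < c & forall f, [set` l] f ->
    c * (cross f v / cross u v) <= cross u f / cross u v.
  by apply: IH => g gl; apply: Hf; rewrite /= in_cons gl orbT.
have [f0|f_gt0] := Hf f (mem_head _ _).
  exists c => // g; rewrite /= in_cons => /orP[/eqP->|]; last exact: Hc.
  by rewrite f0 cross0l cross0r !mul0r mulr0.
set a := cross f v / cross u v; set b := cross u f / cross u v in f_gt0.
(* The summand 1 keeps the denominator positive when [a] vanishes. *)
pose c' := b / (`|a| + 1); have a1 : 0 < `|a| + 1 by rewrite ltr_wpDl.
have c'0 : 0 < c' by rewrite divr_gt0.
exists (Num.min c c'); first by rewrite lt_min c0.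
move=> g; rewrite /= in_cons => /orP[/eqP->|gl].
  rewrite -/a -/b; have [a_le0|a_gt0] := lerP a 0.
    by rewrite (le_trans _ (ltW f_gt0)) // mulr_ge0_le0 // le_min !ltW.
  have : Num.min c c' * a <= c' * a by rewrite ler_wpM2r ?ge_min ?lexx ?orbT // ltW.
  move=> /le_trans; apply; rewrite /c' mulrAC ler_pdivrMr // gtr0_norm //; nra.
set a' := cross g v / cross u v; have := Hc g gl; rewrite -/a'.
have [a_le0|a_gt0] := lerP a' 0; last first.
  by apply: le_trans; rewrite ler_wpM2r ?ge_min ?lexx // ltW.
have := Hf g; rewrite /= in_cons gl orbT => /(_ isT) [->|g0] _.
  by rewrite cross0r mul0r mulr_ge0_le0 // le_min !ltW.
by rewrite (le_trans _ (ltW g0)) // mulr_ge0_le0 // le_min !ltW.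
Qed.

(* If no generator lay on the line of [u], finitely many generators would stay in a cone
   [b >= c a] missing the integral points close to [u]. *)
Lemma edge_generator u v B G : cross u v != 0 -> finite_set B -> finite_set G ->
  B `<=` @integral_vec R 2 ->
  (forall T f, G T -> B f -> 0 <= cross u (act T f) / cross u v) ->
  (forall s, integer_points (cone u v) s -> generated B G s) ->
  integral_multiple u.
Proof.
move=> uv Bfin Gfin Bz Bpos gen; apply: contrapT => nu.
have Ffin := finite_image2 (@act R 2) Gfin Bfin.
have [|c c0 Hc] := finite_slope_bound (u := u) (v := v) Ffin.
  move=> _ [T GT [f Bf <-]].
  (* An image on the line of [u] must be zero, since a nonzero one is an integral multiple of
     [u]. *)
  have := Bpos _ _ GT Bf; rewrite le_eqVlt => /orP[/eqP e|]; last by right.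
  have cr : cross u (act T f) = 0.
    by apply/eqP; rewrite -(mulIr_eq0 _ (mulIf (invr_neq0 uv))) -e.
  have [d dE] := cross_eq0_collinear (cross_neq0l uv) cr.
  have [d0|d0] := eqVneq d 0; first by left; rewrite dE d0 scale0r.
  by case: nu; apply: (integral_multiple_neq0 _ d0 dE); apply: act_integral; exact: Bz.
have [a [b [a0 b0 bc sz]]] := integral_near_ray uv c0.
have [k [l [T [r [Tr sE]]]]] : generated B G (a *: u + b *: v).
  by apply: gen; split=> //; exists a, b; split=> //; exact: ltW.
(* A half-plane closed under addition: it contains every generated point, but not the integral point
   found close to [u]. *)
pose H x := 0 <= cross u x / cross u v - c * (cross x v / cross u v).
have HD x y : H x -> H y -> H (x + y).
  by rewrite /H crossDl crossDr !mulrDl mulrDr; lra.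
have H0 : H 0 by rewrite /H cross0l cross0r !mul0r mulr0 subr0.
have : H (a *: u + b *: v).
  rewrite sE; apply: (big_ind H) => // i _.
  have Hi : H (act (T i) (r i)).
    by rewrite /H subr_ge0; apply: Hc; have [? ?] := Tr i; exists (T i) => //; exists (r i).
  by elim: (l i) => [|m IHm]; rewrite ?mulr0n // mulrS; exact: HD.
by rewrite /H !crossE !mulr0 addr0 add0r !mulfK // subr_ge0 leNgt bc.
Qed.

(** * Automorphisms of a cone, and normal forms of the two kinds of cones *)

(** In the basis [u], [v] both [T] and its inverse have nonnegative entries, so [T] is a monomial
    matrix: diagonal or antidiagonal. *)
Lemma cone_automorphism u v T : cross u v != 0 -> GLZ T ->
  (forall x, cone u v x -> cone u v (act T x)) ->
  (forall x, cone u v x -> cone u v (act (invmx T) x)) ->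
  (exists a d : R, [/\ 0 < a, 0 < d, act T u = a *: u & act T v = d *: v]) \/
  (exists b c : R, [/\ 0 < b, 0 < c, act T u = b *: v & act T v = c *: u]).
Proof.
move=> uv GT TC VC.
have [a [b [a0 b0 Tu]]] := TC _ (cone_left u v).
have [c [d [c0 d0 Tv]]] := TC _ (cone_right u v).
have [a' [b' [a'0 b'0 Vu]]] := VC _ (cone_left u v).
have [c' [d' [c'0 d'0 Vv]]] := VC _ (cone_right u v).
have [e1 e2] : a * a' + b * c' = 1 /\ a * b' + b * d' = 0.
  apply: (cross_inj uv); rewrite scale1r scale0r addr0 -[RHS](actK u GT) Tu.
  by rewrite actD !actZ Vu Vv; apply: cV2P; rewrite !mxE; ring.
have [e3 e4] : c * a' + d * c' = 0 /\ c * b' + d * d' = 1.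
  apply: (cross_inj uv); rewrite scale1r scale0r add0r -[RHS](actK v GT) Tv.
  by rewrite actD !actZ Vu Vv; apply: cV2P; rewrite !mxE; ring.
(* Nonnegative terms with sum zero vanish one by one. *)
have z1 : a * b' = 0 by apply/eqP; rewrite eq_le mulr_ge0 // andbT; have := mulr_ge0 b0 d'0; lra.
have z2 : b * d' = 0 by lra.
have z3 : c * a' = 0 by apply/eqP; rewrite eq_le mulr_ge0 // andbT; have := mulr_ge0 d0 c'0; lra.
have z4 : d * c' = 0 by lra.
have pos (x y : R) : 0 <= x -> x * y = 1 -> 0 < x.
  move=> x0 xy; rewrite lt_def x0 andbT; apply: contra_eq_neq xy => ->.
  by rewrite mul0r eq_sym oner_neq0.
have [aE|aN] := eqVneq a 0.
  right; have bc : b * c' = 1 by rewrite -e1 aE mul0r add0r.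
  have c'N : c' != 0 by apply: contra_eq_neq bc => ->; rewrite mulr0 eq_sym oner_neq0.
  have dE : d = 0 by move/eqP: z4; rewrite mulf_eq0 (negPf c'N) orbF => /eqP.
  have cb : c * b' = 1 by rewrite -e4 dE mul0r addr0.
  exists b, c; split; [exact: pos bc|exact: pos cb| |].
    by rewrite Tu aE scale0r add0r.
  by rewrite Tv dE scale0r addr0.
left; have b'E : b' = 0 by move/eqP: z1; rewrite mulf_eq0 (negPf aN) => /eqP.
have dd : d * d' = 1 by rewrite -e4 b'E mulr0 add0r.
have d'N : d' != 0 by apply: contra_eq_neq dd => ->; rewrite mulr0 eq_sym oner_neq0.
have bE : b = 0 by move/eqP: z2; rewrite mulf_eq0 (negPf d'N) orbF => /eqP.
have aa : a * a' = 1 by rewrite -e1 bE mul0r addr0.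
have a'N : a' != 0 by apply: contra_eq_neq aa => ->; rewrite mulr0 eq_sym oner_neq0.
have cE : c = 0 by move/eqP: z3; rewrite mulf_eq0 (negPf a'N) orbF => /eqP.
exists a, d; split; [exact: pos aa|exact: pos dd| |].
  by rewrite Tu bE scale0r addr0.
by rewrite Tv cE scale0r add0r.
Qed.

Lemma extreme_ray_vector C u : convex_cone C -> extreme_rays C (ray u) ->
  extreme_vector C u.
Proof.
move=> [C0 CD CZ] [w [Cw w0 wext] wu].
have [c /= c0 uE] : ray u w by rewrite -wu; exact: ray_self.
have uE' : u = c^-1 *: w by rewrite -uE scalerA mulVf ?scale1r // gt_eqF.
split; last by rewrite -wu.
- by rewrite uE'; apply: CZ => //; rewrite invr_ge0 ltW.
- by move=> u0; apply: w0; rewrite -uE u0 scaler0.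
Qed.

(** Pointedness makes the two extreme vectors independent; the extremality of each one then forces
    the coordinate along the other to be nonnegative. *)
Lemma pointed_cone_coneE C u1 u2 : convex_cone C -> pointed C ->
  ray u1 <> ray u2 -> extreme_rays C = [set ray u1; ray u2] ->
  cross u1 u2 != 0 /\ C = cone u1 u2.
Proof.
move=> hC pC u12 eC; have [C0 CD CZ] := hC.
have [Cu1 /eqP u10 ext1] : extreme_vector C u1.
  by apply: extreme_ray_vector => //; rewrite eC; left.
have [Cu2 /eqP u20 ext2] : extreme_vector C u2.
  by apply: extreme_ray_vector => //; rewrite eC; right.
have cr : cross u1 u2 != 0.
  apply/eqP => /(cross_eq0_collinear u10)[c cE].
  have [c0|c0] := ltrP 0 c; first by apply: u12; rewrite cE ray_scale.
  move/eqP: u20; apply; apply: pC => //.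
  by rewrite cE -scaleNr; apply: CZ => //; rewrite oppr_ge0.
split=> //; apply/seteqP; split=> [x Cx|x [a [b [a0 b0 ->]]]]; last first.
  by apply: CD; exact: CZ.
(* A negative coordinate would write a multiple of one extreme vector as a sum
   involving the other. *)
have edge v w (a b : R) : cross v w != 0 -> C v -> C w ->
    (forall x y, C x -> C y -> ray w (x + y) ->
      (x = 0 \/ ray w x) /\ (y = 0 \/ ray w y)) ->
    C (a *: v + b *: w) -> 0 <= a.
  move=> vw Cv Cw ext Cab; rewrite leNgt; apply/negP => a0.
  have Na0 : 0 <= - a by rewrite oppr_ge0 ltW.
  have CNa := CZ _ _ Na0 Cv.
  have sumE : (a *: v + b *: w) + (- a) *: v = b *: w.
    by rewrite scaleNr addrC addrA addNr add0r.
  have [b0|b0] := ltrP 0 b.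
    have [_] : (a *: v + b *: w = 0 \/ ray w (a *: v + b *: w)) /\
               ((- a) *: v = 0 \/ ray w ((- a) *: v)).
      by apply: ext => //; rewrite sumE; exists b.
    move=> [/eqP|[d /= d0 dE]].
      by rewrite scaler_eq0 (negPf (cross_neq0l vw)) orbF oppr_eq0 lt_eqF.
    have := congr1 (fun y => cross y w) dE; rewrite !crossE mulr0 => /esym/eqP.
    by rewrite mulf_eq0 (negPf vw) orbF oppr_eq0 lt_eqF.
  (* Here the opposite of [(- a) *: v] is a sum of two members of [C], against pointedness. *)
  have Nb0 : 0 <= - b by rewrite oppr_ge0.
  have /pC : C ((- a) *: v) by [].
  have -> : - (- a *: v) = (a *: v + b *: w) + (- b) *: w.
    by rewrite !scaleNr addrK opprK.
  move=> /(_ (CD _ _ Cab (CZ _ _ Nb0 Cw)))/eqP.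
  by rewrite scaler_eq0 (negPf (cross_neq0l vw)) orbF oppr_eq0 lt_eqF.
have xE := cross_basis x cr; rewrite xE in Cx *.
eexists; eexists; split; last reflexivity.
- exact: edge cr Cu1 Cu2 ext2 Cx.
- by rewrite addrC in Cx; apply: edge _ Cu2 Cu1 ext1 Cx; rewrite crossC oppr_eq0.
Qed.

(** The normal [a], turned by a right angle, lies on the boundary line, so the functional is a
    multiple of [cross r]. Dividing by its value at [q = a^T], an interior point, fixes the sign. *)
Lemma half_planeE C r : closed_half_space_with_boundary_span C r ->
  exists2 q, cross r q != 0 & C = [set x | 0 <= cross r x / cross r q].
Proof.
move=> [a [a0 CE ker]].
have aE x : (a *m x) 0 0 = a 0 0 * x 0 0 + a 0 1 * x 1 0.
  rewrite mxE !big_ord_recl big_ord0 addr0.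
  by have -> : lift ord0 ord0 = 1 :> 'I_2 by exact/val_inj.
pose p : 'cV[R]_2 := \col_i (if i == 0 then - a 0 1 else a 0 0).
have [c _ pE] : [set c *: r | c in [set: R]] p.
  by rewrite -ker /= aE !mxE /=; ring.
have ax x : (a *m x) 0 0 = - (c * cross r x).
  by rewrite -crossZl pE aE /cross !mxE /=; ring.
have aa : (a *m a^T) 0 0 != 0.
  rewrite aE !mxE -!expr2 paddr_eq0 ?sqr_ge0 // !sqrf_eq0.
  apply/negP => /andP[/eqP z0 /eqP z1]; apply: a0; apply/matrixP => i j.
  rewrite (ord1 i) mxE.
  have [->//|->//] : j = 0 \/ j = 1.
  by case: j => -[|[|//]] ltj; [left|right]; exact/val_inj.
have [c0 rq] : c != 0 /\ cross r a^T != 0.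
  by apply/andP; rewrite -negb_or -mulf_eq0 -oppr_eq0 -ax.
have aa0 : 0 < (a *m a^T) 0 0.
  by rewrite lt_def aa aE !mxE -!expr2 addr_ge0 ?sqr_ge0.
exists a^T => //; rewrite CE; apply/seteqP; split=> x /=.
  move=> ax0; have -> : cross r x / cross r a^T = (a *m x) 0 0 / (a *m a^T) 0 0.
    by rewrite !ax; field; rewrite c0 rq.
  by rewrite divr_ge0 // ltW.
move=> rx; have -> : (a *m x) 0 0 = cross r x / cross r a^T * (a *m a^T) 0 0.
  by rewrite !ax; field.
by rewrite mulr_ge0 // ltW.
Qed.

(** The sign of the coordinate along [r] selects the cone. Any interior [v] serves, so it can be
    adapted to the group. *)
Lemma half_plane_cones r q v : cross r q != 0 -> 0 < cross r v / cross r q ->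
  [set x | 0 <= cross r x / cross r q] = cone r v `|` cone (- r) v.
Proof.
move=> rq v0.
have rv : cross r v != 0 by apply: contraTneq v0 => ->; rewrite mul0r ltxx.
apply/seteqP; split=> x /=; last first.
  by case=> [[a [b [a0 b0 ->]]]|[a [b [a0 b0 ->]]]];
    rewrite ?scalerN -?scaleNr !crossE mulr0 add0r -mulrA mulr_ge0 // ltW.
move=> x0; have b0 : 0 <= cross r x / cross r v.
  rewrite -[X in X / _](divfK rq) -[X in _ / X](divfK rq) -mulf_div divff // mulr1.
  by rewrite divr_ge0 // ltW.
rewrite (cross_basis x rv); have [a0|a0] := lerP 0 (cross x v / cross r v).
  by left; do 2!eexists; split; last reflexivity.
right; exists (- (cross x v / cross r v)), (cross r x / cross r v).
by split=> //; [lra|rewrite scalerN scaleNr opprK].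
Qed.

(** * The two equivalences *)

Lemma RG_stable C B G : RG_generated C B G ->
  forall T x, G T -> C x -> C (act T x).
Proof. by move=> [eC _ _] T x GT Cx; rewrite -eC; exists T => //; exists x. Qed.

Lemma fg_subgroup (n : nat) (G : set 'M[int]_n) : fg_subgroup_GLZ G -> subgroup_GLZ G.
Proof. by move=> [X [_ XG ->]]; exact: subgroup_smallest. Qed.

Lemma cone_RG_finitely_generatedP u v : cross u v != 0 ->
  RG_finitely_generated (cone u v) <->
  (rational_ray u /\ rational_ray v) \/
  (exists A, [/\ GLZ A, A <> 1%:M, pos_eigenvector A u & pos_eigenvector A v]).
Proof.
move=> uv; have vu : cross v u != 0 by rewrite crossC oppr_eq0.
have [uN0 vN0] := (cross_neq0l uv, cross_neq0r uv).
split; last first.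
  case=> [[/rational_rayP[x [c [xz c0 xE]]] /rational_rayP[y [d [yz d0 yE]]]]|].
    have xy : cross x y != 0.
      by rewrite xE yE crossZl crossZr !mulf_neq0 // gt_eqF.
    rewrite -(coneZ u v c0 d0) -xE -yE.
    have [B [Bfin Bsub gen]] := gordan xy xz yz.
    apply: (RG_finitely_generated_intro (X := set0) Bfin Bsub) => //.
    by move=> G s sG _; exact: gen.
  move=> [A [GA AN1 [_ [a a0 Au]] [_ [b b0 Av]]]].
  (* Two positive eigenvalues exclude determinant -1. *)
  have ab : a * b = 1.
    have := eigen_det uv Au Av; case: GA => -> //.
    by rewrite rmorphN => e; have := mulr_gt0 a0 b0; lra.
  have bE : b = a^-1 by apply: (mulfI (lt0r_neq0 a0)); rewrite ab mulfV // gt_eqF.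
  have a1 : a != 1.
    apply/eqP => a1; apply: AN1; apply: (act_fix_basis uv).
      by rewrite Au a1 scale1r.
    by rewrite Av bE a1 invr1 scale1r.
  rewrite {}bE in b0 Av {ab}.
  have [B [Bfin Bsub gen]] := hyperbolic_generation_neq1 uv GA a0 a1 Au Av.
  apply: (RG_finitely_generated_intro (X := [set A]) Bfin Bsub) => //.
  - by move=> T ->.
  - by move=> T x ->; exact: cone_act_iff Au Av.
  - by move=> G s sG AG; apply: gen => //; exact: AG.
move=> [B [G [Bfin Bsub /fg_subgroup sG RG]]].
have [[A [GA A1 Au Av]]|noA] := pselect (exists A,
    [/\ GLZ A, A <> 1%:M, pos_eigenvector A u & pos_eigenvector A v]).
  by right; exists A.
left; have TC := RG_stable RG; have [GG G1 GM GV] := sG.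
pose P := [set T | pos_eigenvector T u /\ pos_eigenvector T v].
have swap T : G T -> ~ P T ->
    exists b c : R, [/\ 0 < b, 0 < c, act T u = b *: v & act T v = c *: u].
  move=> GT PT.
  have [] := cone_automorphism uv (GG _ GT) (fun x => TC T x GT) (fun x => TC _ x (GV _ GT)) => //.
  by move=> [a [d [a0 d0 Tu Tv]]]; case: PT; split; split; [exact/eqP|exists a|exact/eqP|exists d].
have Gfin : finite_set G.
  (* Two exchanges of the rays compose to a positive scaling of each. *)
  apply: (@finite_subgroup_index2 _ _ P) => //.
    move=> T GT [Tu Tv]; apply: contrapT => T1; apply: noA; exists T.
    by split=> //; exact: GG.
  move=> T T' GT GT' /(swap _ GT)[b [c [b0 c0 Tu Tv]]] /(swap _ GT')[b' [c' [b'0 c'0 T'u T'v]]].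
  split; split; [exact/eqP| |exact/eqP|].
    by exists (b' * c); [exact: mulr_gt0|rewrite actM T'u actZ Tv scalerA].
  by exists (c' * b); [exact: mulr_gt0|rewrite actM T'v actZ Tu scalerA].
have Bz : B `<=` @integral_vec R 2 by move=> x /Bsub[].
have gen : forall s, integer_points (cone u v) s -> generated B G s by case: RG.
have pos T f : G T -> B f -> cone u v (act T f).
  by move=> GT /Bsub[Cf _]; exact: TC.
split; apply/rational_rayP.
  apply: (edge_generator uv Bfin Gfin Bz _ gen) => T f GT Bf.
  by have [a [b [a0 b0 ->]]] := pos _ _ GT Bf; rewrite !crossE mulr0 add0r mulfK.
rewrite coneC in gen pos.
apply: (edge_generator vu Bfin Gfin Bz _ gen) => T f GT Bf.
by have [a [b [a0 b0 ->]]] := pos _ _ GT Bf; rewrite !crossE mulr0 add0r mulfK.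
Qed.

Lemma half_plane_RG_finitely_generatedP r q : cross r q != 0 ->
  RG_finitely_generated [set x | 0 <= cross r x / cross r q] <->
  rational_direction r \/
  (exists A, [/\ GLZ A, \det A = 1, A <> 1%:M & pos_eigenvector A r]).
Proof.
move=> rq; have rN0 := cross_neq0l rq.
set C := [set x | _]; split; last first.
  (* The rational case comes first, because an eigenvalue 1 of [A] at [r] would make [r] rational;
     afterwards [lam != 1]. *)
  move=> hyp; have [rat|irr] := pselect (rational_direction r).
    have [x [c [xz c0 xE]]] := (rational_directionP r).1 rat.
    have xN0 : x != 0 by rewrite xE scaler_eq0 gt_eqF.
    (* [x] turned by a right angle is integral and off the boundary; up to sign it is interior. *)
    pose e : 'cV[R]_2 := \col_i (if i == 0 then - x 1 0 else x 0 0).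
    have ez : integral_vec e.
      case: xz => z _ zE; exists (\col_i (if i == 0 then - z 1 0 else z 0 0)) => //.
      by apply: cV2P; rewrite !mxE /= -zE !mxE // rmorphN.
    have xe : cross r e != 0.
      suff : c * cross r e != 0 by rewrite mulf_eq0 negb_or => /andP[].
      rewrite -crossZl -xE /cross !mxE /= mulrN opprK -!expr2 paddr_eq0 ?sqr_ge0 //.
      apply/negP; rewrite !sqrf_eq0 => /andP[/eqP z0 /eqP z1].
      by move/eqP: xN0; apply; apply: cV2P; rewrite mxE.
    have [v vz v0] : exists2 v, integral_vec v & 0 < cross r v / cross r q.
      have [e0|e0|/eqP] := ltgtP 0 (cross r e / cross r q); first by exists e.
        exists (- e); first exact: integral_vecN.
        by rewrite -scaleN1r crossZr mulN1r mulNr oppr_gt0.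
      by rewrite eq_sym mulf_eq0 invr_eq0 (negPf xe) (negPf rq).
    have rv : cross r v != 0 by apply: contraTneq v0 => ->; rewrite mul0r ltxx.
    have xv : cross x v != 0 by rewrite xE crossZl mulf_neq0 // gt_eqF.
    have CE : C = cone x v `|` cone (- x) v.
      rewrite /C (half_plane_cones rq v0) xE -scalerN.
      by rewrite -(coneZ r v c0 ltr01) -(coneZ (- r) v c0 ltr01) scale1r.
    have [|B2 [B2fin B2sub gen2]] := gordan _ (integral_vecN xz) vz.
      by rewrite -scaleN1r crossZl mulN1r oppr_eq0.
    have [B1 [B1fin B1sub gen1]] := gordan xv xz vz.
    apply: (RG_finitely_generated_intro (B := B1 `|` B2) (X := set0)) => //.
    - by rewrite finite_setU.
    - rewrite CE => y [/B1sub|/B2sub] [yC yz]; split=> //; [by left|by right].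
    - rewrite CE => G s sG _ [[sC|sC] sz].
        by apply: generated_sub (gen1 _ _ sG _) => //; exact: subsetUl.
      by apply: generated_sub (gen2 _ _ sG _) => //; exact: subsetUr.
  case: hyp => // -[A [GA dA AN1 [_ [lam lam0 Ar]]]].
  have lam1 : lam != 1.
    apply: contra_notN irr => /eqP lam1; apply/rational_directionP.
    by apply: (fixed_integral_multiple AN1 rN0); rewrite Ar lam1 scale1r.
  (* In the basis [r], [q] the matrix of [A] is upper triangular with diagonal [lam], [nu], so
     determinant 1 gives [nu = lam^-1]. *)
  pose g := cross (act A q) q / cross r q; pose nu := cross r (act A q) / cross r q.
  have Aq : act A q = g *: r + nu *: q by exact: cross_basis.
  have nuE : nu = lam^-1.
    have := cross_act A r q; rewrite dA mul1r Ar Aq !crossE mulr0 add0r => e.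
    apply: (mulfI (lt0r_neq0 lam0)); rewrite mulfV ?gt_eqF //.
    by apply: (mulIf rq); rewrite -mulrA e mul1r.
  have nulam : nu - lam != 0.
    rewrite subr_eq0 nuE; apply: contra_neq lam1 => e.
    have : lam * lam = 1 by rewrite -{1}e mulVf // gt_eqF.
    by move=> ll; apply/eqP; rewrite -(@eqrXn2 _ 2) ?ltW // expr1n expr2 ll.
  (* The multiple of [r] that turns [q] into an eigenvector for [nu]. *)
  pose v := q + (g / (nu - lam)) *: r.
  have Av : act A v = lam^-1 *: v.
    rewrite -nuE actD actZ Ar Aq; apply: cV2P; rewrite !mxE; field; exact: nulam.
  have rv : cross r v = cross r q by rewrite !crossE mulr0 addr0.
  have rvN0 : cross r v != 0 by rewrite rv.
  have v0 : 0 < cross r v / cross r q by rewrite rv divff.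
  have CE : C = cone r v `|` cone (- r) v by rewrite /C (half_plane_cones rq v0).
  have ANr : act A (- r) = lam *: - r by rewrite actN Ar scalerN.
  have [|B2 [B2fin B2sub gen2]] := hyperbolic_generation_neq1 _ GA lam0 lam1 ANr Av.
    by rewrite -scaleN1r crossZl mulN1r oppr_eq0.
  have [B1 [B1fin B1sub gen1]] := hyperbolic_generation_neq1 rvN0 GA lam0 lam1 Ar Av.
  have lamV : 0 < lam^-1 by rewrite invr_gt0.
  apply: (RG_finitely_generated_intro (B := B1 `|` B2) (X := [set A])) => //.
  - by rewrite finite_setU.
  - rewrite CE => y [/B1sub|/B2sub] [yC yz]; split=> //; [by left|by right].
  - by move=> T ->.
  - move=> T x ->; rewrite CE /setU /=.
    by rewrite (cone_act_iff x GA lam0 lamV Ar Av) (cone_act_iff x GA lam0 lamV ANr Av).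
  - rewrite CE => G s sG AG [[sC|sC] sz].
      by apply: generated_sub (gen1 _ _ sG (AG _ erefl) _) => //; exact: subsetUl.
    by apply: generated_sub (gen2 _ _ sG (AG _ erefl) _) => //; exact: subsetUr.
move=> [B [G [Bfin Bsub /fg_subgroup sG RG]]].
have [[A [GA dA A1 Ar]]|noA] := pselect (exists A,
    [/\ GLZ A, \det A = 1, A <> 1%:M & pos_eigenvector A r]).
  by right; exists A.
left; apply/rational_directionP.
have TC := RG_stable RG; have [GG G1 GM GV] := sG.
have Cr : C r by rewrite /C /= crossxx mul0r.
have CNr : C (- r) by rewrite /C /= -scaleN1r crossZr crossxx mulr0 mul0r.
have Cq : C q by rewrite /C /= divff.
have eig T : G T -> \det T = 1 -> pos_eigenvector T r.
  move=> GT dT; split; first exact/eqP.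
  (* [C] contains the images of both [r] and [- r], so they lie on the boundary. *)
  have Tr0 : cross r (act T r) = 0.
    have := TC _ _ GT Cr; have := TC _ _ GT CNr.
    rewrite /C /= actN -scaleN1r crossZr mulN1r mulNr oppr_ge0 => le0 ge0.
    have /eqP : cross r (act T r) / cross r q = 0 by apply/eqP; rewrite eq_le le0.
    by rewrite mulf_eq0 invr_eq0 (negPf rq) orbF => /eqP.
  have [mu Tr] := cross_eq0_collinear rN0 Tr0.
  (* The coordinate along [q] of [act T q] is nonnegative, and its product with [mu] is the
     determinant 1. *)
  exists mu => //; have nu0 := TC _ _ GT Cq; rewrite /C /= in nu0.
  have : mu * (cross r (act T q) / cross r q) = 1.
    by rewrite mulrA -crossZl -Tr cross_act dT mul1r divff.
  set nu := _ / _ in nu0 *; move=> e.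
  by rewrite ltNge; apply/negP => mu0; have := mulr_le0_ge0 mu0 nu0; rewrite e; lra.
have Gfin : finite_set G.
  apply: (@finite_subgroup_index2 _ _ [set T | \det T = 1]) => //.
    move=> T GT /= dT; apply: contrapT => T1; apply: noA; exists T.
    by split=> //; [exact: GG|exact: eig].
  move=> T T' GT GT' /= dT dT'; rewrite det_mulmx.
  by have [//|->] := GG _ GT; have [//|->] := GG _ GT'; rewrite mulrNN mulr1.
apply: (edge_generator rq Bfin Gfin).
- by move=> x /Bsub[].
- by move=> T f GT /Bsub[Cf _]; exact: TC.
(* [cone r q] lies in the half-plane, so its integral points are generated. *)
- move=> s [[a [b [a0 b0 sE]]] sz]; case: RG => _ _; apply; split=> //.
  by rewrite /C /= sE !crossE mulr0 add0r mulfK.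
Qed.

End Plane.

Theorem theorem1p6 (R : realType) (C : set 'cV[R]_2) (hC : convex_cone C) :
  (forall u1 u2 : 'cV[R]_2,
     pointed C ->
     ray u1 <> ray u2 ->
     extreme_rays C = [set ray u1; ray u2] ->
     (RG_finitely_generated C <->
      (rational_ray u1 /\ rational_ray u2) \/
      (exists A : 'M[int]_2,
         [/\ GLZ A, A <> 1%:M, pos_eigenvector A u1 & pos_eigenvector A u2])))
  /\
  (forall r : 'cV[R]_2,
     closed_half_space_with_boundary_span C r ->
     (RG_finitely_generated C <->
      rational_direction r \/
      (exists A : 'M[int]_2,
         [/\ GLZ A, \det A = 1, A <> 1%:M & pos_eigenvector A r]))).
Proof.
split=> [u1 u2 pC u12 eC|r hr].
  have [cr CE] := pointed_cone_coneE hC pC u12 eC.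
  by rewrite CE; exact: cone_RG_finitely_generatedP.
have [q rq CE] := half_planeE hr.
by rewrite CE; exact: half_plane_RG_finitely_generatedP.
Qed.
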